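(* Let $(\mathfrak h,(H_i,L_i)_{i\in I})$ be a linear Coxeter system with linear Coxeter group $\mathcal W$, closed fundamental chamber $\overline C$ and Tits cone $X$. Let $Y\subseteq X$ be a $\mathcal W$-invariant convex subcone containing $0$, and let $R\in\Upsilon$. (a) The pointwise stabilizer of $R$ and the stabilizer of $R$ as a whole are given by $$Z_{\mathcal W}(R)=\mathcal W_{\upsilon_*(R)}\quad\text{and}\quad N_{\mathcal W}(R)=\mathcal W_{\upsilon(R)}.$$ (b) We have $R\cap\overline C=R\cap\overline F_{\upsilon_*(R)}$, and $$R=N_{\mathcal W}(R)(R\cap\overline C)=\mathcal W_{\upsilon^*(R)}\big(R\cap\overline F_{\upsilon_*(R)}\big),$$ where $\mathrm{ri}(R)\cap F_{\upsilon_*(R)}\ne\emptyset$. In particular, the set $\upsilon_*(R)$ is facial.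
   Context: $\mathbb R^+_0=[0,\infty)$, $\mathbb R^+=(0,\infty)$. A convex cone is a subset of a real vector space closed under addition and under multiplication by elements of $\mathbb R^+$. $\mathrm{ri}$ denotes the relative interior of a finite-dimensional convex set. For a convex cone $K$ containing $0$, a face of $K$ is a convex cone $F\subseteq K$ with $(K\setminus F)+K\subseteq K\setminus F$; $\mathrm{Fa}(K)$ is the set of nonempty faces, ordered by inclusion. Linear Coxeter systems. Let $\mathfrak h$ be a finite-dimensional real vector space, $n\ge1$, $I=\{1,\dots,n\}$. For a zero-based closed ray $H\subseteq\mathfrak h$ put $H^{\ge0}=\{\lambda\in\mathfrak h^*\mid\lambda(h)\ge0\ \forall h\in H\}$, $H^{>0}=\{\lambda\mid\lambda(h)>0\ \forall h\in H\setminus\{0\}\}$, $H^{=0}=\{\lambda\mid\lambda(h)=0\ \forall h\in H\}$. A linear Coxeter system $(\mathfrak h,(H_i,L_i)_{i\in I})$ consists of zero-based closed rays $H_i\subseteq\mathfrak h$, $L_i\subseteq\mathfrak h^*$ with $L_i\setminus\{0\}\subseteq H_i^{>0}$ such that: (1) the closed fundamental chamber $\overline C=\bigcap_{i\in I}H_i^{\ge0}$ spans $\mathfrak h^*$, and $\overline C\cap H_i^{=0}$, $i\in I$, are its pairwise different faces of codimension 1; (2) with $C=\bigcap_{i\in I}H_i^{>0}$ and $\mathcal W$ (the linear Coxeter group) the group generated by the reflections $\sigma_i$ on $\mathfrak h^*$ at the hyperplane $H_i^{=0}$ along the line $L_i\cup(-L_i)$, one has $\sigma C\cap C=\emptyset$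 for all $\sigma\in\mathcal W\setminus\{1\}$. Then $(\mathcal W,(\sigma_i)_{i\in I})$ is a Coxeter system; $\mathcal W_J$ is the subgroup generated by $\sigma_j$, $j\in J$. The Tits cone is the convex cone $X=\bigcup_{\sigma\in\mathcal W}\sigma\overline C$. For each $i$ fix $h_i\in H_i$, $\alpha_i\in L_i$ with $\alpha_i(h_i)=2$ (nothing below depends on the choice). For $J\subseteq I$ set $F_J=\{\lambda\in\mathfrak h^*\mid\lambda(h_i)=0\ (i\in J),\ \lambda(h_i)>0\ (i\in I\setminus J)\}$ and $\overline F_J=\{\lambda\in\mathfrak h^*\mid\lambda(h_i)=0\ (i\in J),\ \lambda(h_i)\ge0\ (i\in I\setminus J)\}$. $J\subseteq I$ is facial if $\sum_{j\in J}\mathbb R^+_0h_j$ is a face of $\sum_{i\in I}\mathbb R_0^+h_i$ (empty sum $=\{0\}$). Cross section lattice and type maps of $Y$. $\Upsilon=\{R\in\mathrm{Fa}(Y)\mid\mathrm{ri}(R)\cap\overline C\ne\emptyset\}$. For $R\in\Upsilon$: $\upsilon(R)=\{i\in I\mid\sigma_iR=R\}$, $\upsilon_*(R)=\{i\in I\mid\sigma_i\text{ fixes }R\text{ pointwise}\}=\{i\in I\mid R-R\subseteq H_i^{=0}\}$, $\upsilon^*(R)=\upsilon(R)\setminus\upsilon_*(R)=\{i\in I\mid L_i\subseteq R-R\}$. Further, $Z_{\mathcal W}(R)=\{\sigma\in\mathcal W\mid\sigma\lambda=\lambda\ \forall\lambda\in R\}$ and $N_{\mathcal W}(R)=\{\sigma\in\mathcal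 W\mid\sigma R=R\}$. *)

(* Defs.v *)
From HB Require Import structures.
From mathcomp Require Import all_boot all_order all_algebra.
From mathcomp Require Import boolp classical_sets reals.
Set Implicit Arguments.
Unset Strict Implicit.
Unset Printing Implicit Defensive.
Import Order.TTheory GRing.Theory Num.Theory.
Local Open Scope classical_set_scope.
Local Open Scope ring_scope.

Section Convexity.
Variables (R : realType) (V : vectType R).
Implicit Types (A B K F : set V) (U : {vspace V}).

(* Neither 0 nor nonemptiness is required. *)
Definition convex_cone A : Prop :=
  (forall x y, A x -> A y -> A (x + y)) /\
  (forall (t : R) x, 0 < t -> A x -> A (t *: x)).

Definition face K F : Prop :=
  [/\ convex_cone F, F `<=` K &
      forall x y, (K `\` F) x -> K y -> (K `\` F) (x + y)].

Definition Fa K : set (set V) := [set F | face K F /\ F !=set0].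

Definition is_span A U : Prop :=
  A `<=` [set` U] /\ forall U', A `<=` [set` U'] -> (U <= U')%VS.

(* Dimensions of convex cones containing 0 are those of their linear spans. *)
Definition codim1_face K F : Prop :=
  Fa K F /\
  exists U U', [/\ is_span F U, is_span K U' & \dim U' = (\dim U).+1].

Definition is_affine A : Prop :=
  forall (t : R) x y, A x -> A y -> A ((1 - t) *: x + t *: y).

Definition affine_hull A : set V := smallest is_affine A.

(* Interior relative to the affine hull, for the norm topology of V; neighbourhoods
   are given by the sup norm of the coordinates in a fixed basis of V. *)
Definition ri A : set V :=
  [set x | A x /\ exists2 e : R, 0 < e &
     forall y, affine_hull A y ->
       (forall i, `|coord (vbasis {:V}) i (y - x)| < e) -> A y].

Definition is_ray A : Prop :=
  exists2 x, x != 0 & A = [set t *: x | t in [set t : R | 0 <= t]].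

(* [s^-1] is a true inverse, as [lker s = 0] makes [s] bijective. *)
Definition is_subgroup (G : set 'End(V)) : Prop :=
  [/\ forall s, G s -> lker s = 0%VS, G \1%VF,
      forall s t, G s -> G t -> G (s \o t)%VF &
      forall s, G s -> G (s^-1)%VF].

Definition generated (S : set 'End(V)) : set 'End(V) := smallest is_subgroup S.

Definition is_reflection (P l : set V) (s : 'End(V)) : Prop :=
  (forall x, P x -> s x = x) /\ (forall x, l x -> s x = - x).

(* The linear map fixing the hyperplane P pointwise and acting as -1 on the
   line l; see [coxeter_reflE] for its existence and uniqueness. *)
Definition reflection (P l : set V) : 'End(V) :=
  xget \1%VF [set s | is_reflection P l s].

End Convexity.

Section Dual.
Variables (R : realType) (hV : vectType R).
Local Notation dual := 'Hom(hV, R^o).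

Definition dual_ge0 (A : set hV) : set dual :=
  [set l | forall x, A x -> 0 <= l x].
Definition dual_gt0 (A : set hV) : set dual :=
  [set l | forall x, A x -> x != 0 -> 0 < l x].
Definition dual_eq0 (A : set hV) : set dual :=
  [set l | forall x, A x -> l x = 0].

Section Coxeter.
Variables (n : nat) (H : 'I_n -> set hV) (L : 'I_n -> set dual).
Implicit Types (J : set 'I_n) (s : 'End(dual)) (Y Q : set dual).

Definition closed_chamber : set dual := \bigcap_(i in setT) dual_ge0 (H i).

Definition open_chamber : set dual := \bigcap_(i in setT) dual_gt0 (H i).

Definition coxeter_refl (i : 'I_n) : 'End(dual) :=
  reflection (dual_eq0 (H i)) (L i `|` [set - a | a in L i]).

Definition parabolic J : set 'End(dual) :=
  generated [set coxeter_refl j | j in J].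

Definition coxeter_group : set 'End(dual) := parabolic setT.

Record linear_coxeter_system : Prop := LinearCoxeterSystem {
  lcs_n_gt0 : (0 < n)%N;
  lcs_rayH : forall i, is_ray (H i);
  lcs_rayL : forall i, is_ray (L i);
  lcs_L_pos : forall i, L i `\ 0 `<=` dual_gt0 (H i);
  lcs_chamber_span : is_span closed_chamber fullv;
  lcs_facets : forall F : set dual, codim1_face closed_chamber F <->
    exists i, F = closed_chamber `&` dual_eq0 (H i);
  lcs_facets_inj : injective (fun i => closed_chamber `&` dual_eq0 (H i));
  lcs_chamber_disj : forall s, coxeter_group s -> s <> \1%VF ->
    (s @` open_chamber) `&` open_chamber = set0
}.

Definition tits_cone : set dual :=
  \bigcup_(s in coxeter_group) (s @` closed_chamber).

Definition coxeter_invariant Y : Prop :=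
  forall s, coxeter_group s -> s @` Y = Y.

Definition Upsilon Y : set (set dual) :=
  [set Q | Fa Y Q /\ ri Q `&` closed_chamber !=set0].

Definition upsilon Q : set 'I_n := [set i | coxeter_refl i @` Q = Q].

Definition upsilon_low Q : set 'I_n :=
  [set i | forall l, Q l -> coxeter_refl i l = l].

Definition upsilon_up Q : set 'I_n := upsilon Q `\` upsilon_low Q.

Definition pointwise_stabilizer Q : set 'End(dual) :=
  [set s | coxeter_group s /\ forall l, Q l -> s l = l].

Definition setwise_stabilizer Q : set 'End(dual) :=
  [set s | coxeter_group s /\ s @` Q = Q].

Definition translates (G : set 'End(dual)) (A : set dual) : set dual :=
  \bigcup_(s in G) (s @` A).

End Coxeter.

Section Facets.
Variables (n : nat) (h : 'I_n -> hV).
Implicit Type J : set 'I_n.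

Definition open_facet J : set dual :=
  [set l | forall i, (J i -> l (h i) = 0) /\ (~ J i -> 0 < l (h i))].

Definition closed_facet J : set dual :=
  [set l | forall i, (J i -> l (h i) = 0) /\ (~ J i -> 0 <= l (h i))].

Definition ray_sum J : set hV :=
  [set \sum_(j in J) c j *: h j | c in [set c : 'I_n -> R | forall j, 0 <= c j]].

Definition facial J : Prop := face (ray_sum setT) (ray_sum J).

End Facets.

Lemma coxeter_reflE n (H : 'I_n -> set hV) (L : 'I_n -> set dual) i
    (h : hV) (a : dual) :
  is_ray (H i) -> is_ray (L i) -> H i h -> L i a -> a h = 2 ->
  forall l, coxeter_refl H L i l = l - l h *: a.
Proof.
rewrite /coxeter_refl => -[h0 h0N0 ->] [a0 a0N0 ->] [u /= u0 uE] [v /= v0 vE] ah l.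
have two0 : (2 : R) != 0 by rewrite pnatr_eq0.
have uN0 : u != 0.
  by apply: contra_eq_neq ah => u0'; rewrite -uE u0' scale0r linear0 eq_sym.
have vN0 : v != 0.
  by apply: contra_eq_neq ah => v0'; rewrite -vE v0' scale0r zero_lfunE eq_sym.
pose f (l : dual) : dual := l - l h *: a.
have f_lin : linear f.
  move=> c x y; rewrite /f add_lfunE scale_lfunE scalerDl scalerBr scalerA.
  by rewrite opprD addrACA.
pose fL := GRing.isLinear.Build _ _ _ _ f f_lin.
pose f' : {linear dual -> dual} := HB.pack f fL.
have fP x : linfun f' x = x - x h *: a by rewrite lfunE.
have refl_f : is_reflection
    (dual_eq0 [set t *: h0 | t in [set t : R | 0 <= t]])
    ([set t *: a0 | t in [set t : R | 0 <= t]] `|`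
     [set - b | b in [set t *: a0 | t in [set t : R | 0 <= t]]]) (linfun f').
  have fa t : linfun f' (t *: a0) = - (t *: a0).
    have -> : a0 = v^-1 *: a by rewrite -vE scalerA mulVf ?scale1r.
    rewrite fP !scale_lfunE ah !scalerA /GRing.scale /= -scalerBl -scaleNr.
    by congr (_ *: _); rewrite mulr_natr mulr2n opprD addrA subrr sub0r.
  split=> [x x0|x [[t _ <-]|[_ [t _ <-] <-]]]; last 2 first.
  - exact: fa.
  - by rewrite linearN /= fa.
  by rewrite fP x0 ?scale0r ?subr0 //; exists u.
rewrite /reflection.
have /xgetPex - /(_ \1%VF) [] := ex_intro _ _ refl_f.
set s := xget _ _ => s_fix s_neg.
have sa : s a = - a by apply: s_neg; left; exists v.
pose c := l h / 2.
have lE : l = (l - c *: a) + c *: a by rewrite subrK.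
have fixl : s (l - c *: a) = l - c *: a.
  apply: s_fix => _ [t _ <-].
  have -> : h0 = u^-1 *: h by rewrite -uE scalerA mulVf ?scale1r.
  rewrite scalerA linearZ /= add_lfunE opp_lfunE scale_lfunE ah.
  by rewrite /c /GRing.scale /= divfK // subrr mulr0.
transitivity (s (l - c *: a + c *: a)); first by rewrite -lE.
rewrite linearD [X in _ + X]linearZ /= fixl sa scalerN -addrA -opprD -scalerDl.
by rewrite /c -splitr.
Qed.

End Dual.

(* Main.v *)
(* Write sg_i for the reflections and C for the open chamber. As w C is disjoint from
   sg_i w C, it lies on one side of the hyperplane of i; if this is the negative side,
   some gallery from C to w C crosses the hyperplane and deleting the crossed wall
   shortens a word for w. This exchange property shows that w x, x both in the closed
   chamber forces w x = x with w in the parabolic subgroup of the walls containing x,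
   and that each point of the Tits cone can be moved by any parabolic subgroup W_J into
   the region where the coroots of J are nonnegative.
   A face of Y containing a point of ri Q contains Q, so every w that fixes a point of
   ri Q maps Q onto itself. Minimising the number of walls through a point of ri Q in
   the closed chamber gives a point l lying only on the walls that contain Q; hence the
   pointwise stabilizer. If x in Q is on the negative side of the wall of i, then the
   segment from l to x meets this wall in ri Q, so sg_i stabilizes Q: moving x by the
   group of upsilon^* therefore brings it into the closed chamber. *)
From HB Require Import structures.
Require Import Defs.
From mathcomp Require Import all_boot all_order all_algebra.
From mathcomp Require Import boolp classical_sets reals.
From mathcomp Require Import ring lra.
Import Order.TTheory GRing.Theory Num.Theory.
Local Open Scope classical_set_scope.
Local Open Scope ring_scope.

Set Implicit Arguments.
Unset Strict Implicit.

(** * Strict inequalities under small positive parameters *)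

Lemma finite_eventually_small (R : realType) (I : finType) (P : I -> R -> Prop) :
  (forall i, exists2 d, 0 < d & forall e, 0 < e -> e <= d -> P i e) ->
  exists2 d, 0 < d & forall i e, 0 < e -> e <= d -> P i e.
Proof.
move=> H; have /choice [d dP] : forall i, exists d, 0 < d /\ forall e, 0 < e -> e <= d -> P i e.
  by move=> i; have [d] := H i; exists d.
suff [d0 d0_gt0 d0d] : exists2 d0, 0 < d0 & forall i, i \in enum I -> d0 <= d i.
  exists d0 => // i e e0 ed; apply: (dP i).2 => //.
  by apply: le_trans ed (d0d _ _); rewrite mem_enum.
elim: (enum I) => [|i s [d0 d0_gt0 d0d]]; first by exists 1.
exists (Num.min (d i) d0); first by rewrite lt_min d0_gt0 (dP i).1.
move=> j; rewrite inE ge_min => /orP[/eqP ->|/d0d ->]; first by rewrite lexx.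
by rewrite orbT.
Qed.

Lemma small_mul_le (R : realType) (a b : R) : 0 < a ->
  exists2 d, 0 < d & forall e, 0 < e -> e <= d -> e * `|b| < a.
Proof.
move=> a0; exists (a / (`|b| + 1)); first by rewrite divr_gt0 // ltr_wpDl.
move=> e e0; rewrite ler_pdivlMr ?ltr_wpDl // mulrDr mulr1 => h.
by apply: lt_le_trans h; rewrite ltrDl.
Qed.

Lemma small_perturb_gt0 (R : realType) (a b : R) : 0 < a ->
  exists2 d, 0 < d & forall e, 0 < e -> e <= d -> 0 < a + e * b.
Proof.
move=> /(@small_mul_le _ _ b) [d d0 dP]; exists d => // e e0 /(dP _ e0).
by have := ler_norm (- (e * b)); rewrite normrN normrM (gtr0_norm e0); lra.
Qed.

(** * Relative interiors and faces of convex cones *)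

Section RelativeInterior.
Variables (R : realType) (V : vectType R).
Implicit Types (A F G K : set V) (x y : V).

Lemma convex_cone_comb A (a b : R) x y :
  convex_cone A -> 0 < a -> 0 < b -> A x -> A y -> A (a *: x + b *: y).
Proof. by move=> [AD AZ] a0 b0 Ax Ay; exact: AD (AZ _ _ a0 Ax) (AZ _ _ b0 Ay). Qed.

Lemma affine_hull_comb A (t : R) x y :
  affine_hull A x -> affine_hull A y -> affine_hull A ((1 - t) *: x + t *: y).
Proof. by move=> Ax Ay B Bp; have [Baff _] := Bp; exact: Baff (Ax B Bp) (Ay B Bp). Qed.

Lemma sub_affine_hull A : A `<=` affine_hull A.
Proof. by move=> x Ax B [_]; exact. Qed.

Lemma ri_extend A x y : ri A x -> A y ->
  exists2 e : R, 0 < e & A ((1 + e) *: x - e *: y).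
Proof.
move=> [Ax [d d0 dA]] Ay.
have [e e0 eP] : exists2 e : R, 0 < e & forall i, forall e', 0 < e' -> e' <= e ->
    e' * `|coord (vbasis {:V}) i (x - y)| < d.
  by apply: finite_eventually_small => i; exact: small_mul_le.
exists e => //; apply: dA => [|i].
  have := @affine_hull_comb A (- e) x y (sub_affine_hull Ax) (sub_affine_hull Ay).
  by rewrite opprK scaleNr.
have -> : (1 + e) *: x - e *: y - x = e *: (x - y).
  by rewrite scalerDl scale1r scalerBr addrAC [x + _]addrC addrK.
by rewrite linearZ /= normrM (gtr0_norm e0) eP.
Qed.

(** The homothety centred at [y] with ratio [1 - t] carries [x] to [p]. A point [z] of the affine
    hull near [p] is thus the image of a point [x'] near [x], and this [x'] is in [A]. *)
Lemma ri_segment A (t : R) x y : convex_cone A -> ri A x -> A y -> 0 < t -> t < 1 ->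
  ri A ((1 - t) *: x + t *: y).
Proof.
move=> Acone [Ax [d d0 dA]] Ay t0 t1; have s0 : 0 < 1 - t by rewrite subr_gt0.
split; first exact: convex_cone_comb.
exists ((1 - t) * d); first exact: mulr_gt0.
set p := _ + _; move=> z Az zd.
pose x' := (1 - t)^-1 *: (z - t *: y).
have zE : z = (1 - t) *: x' + t *: y.
  by rewrite /x' scalerA divff ?gt_eqF // scale1r subrK.
rewrite zE; apply: convex_cone_comb => //; apply: dA => [|i].
  have := affine_hull_comb (1 - (1 - t)^-1) Az (sub_affine_hull Ay).
  suff -> : (1 - (1 - (1 - t)^-1)) *: z + (1 - (1 - t)^-1) *: y = x' by [].
  rewrite /x' subKr scalerBr scalerA -scaleNr; congr (_ + _ *: _).
  by field; rewrite gt_eqF.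
have -> : x' - x = (1 - t)^-1 *: (z - p).
  rewrite {1}zE /p opprD addrACA subrr addr0 -scalerBr scalerA mulVf ?scale1r //.
  by rewrite gt_eqF.
by rewrite linearZ /= normrM gtr0_norm ?invr_gt0 // mulrC ltr_pdivrMr // mulrC.
Qed.

(** Prolonging the segment from [y] past [x] inside [F] writes [(1 + e) *: x] as the sum of [e *: y]
    and a point of [K]. If [y] were outside [G], so would be this sum, although [x] lies in the cone
    [G]. *)
Lemma ri_sub_face K F G x : convex_cone K -> face K G -> F `<=` K ->
  ri F x -> G x -> F `<=` G.
Proof.
move=> [_ KZ] [[_ GZ] _ Gface] FK xF Gx y Fy; have [e e0 Fz] := ri_extend xF Fy.
apply: contrapT => Gy.
have : (K `\` G) (e *: y + ((1 + e) *: x - e *: y)).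
  apply: Gface; last exact: FK.
  split=> [|Gey]; first exact: KZ _ _ e0 (FK _ Fy).
  apply: Gy; have ei : 0 < e^-1 by rewrite invr_gt0.
  by have := GZ _ _ ei Gey; rewrite scalerA mulVf ?gt_eqF // scale1r.
by rewrite addrC subrK => -[_]; apply; apply: GZ => //; rewrite ltr_wpDl.
Qed.

End RelativeInterior.

(** * Reflections, walls and chambers in terms of coroot pairings *)

Section Reflections.
Variables (R : realType) (hV : vectType R) (n : nat).
Local Notation dual := 'Hom(hV, R^o).
Variables (H : 'I_n -> set hV) (L : 'I_n -> set dual).
Variables (h : 'I_n -> hV) (alpha : 'I_n -> dual).
Hypotheses (HL : linear_coxeter_system H L).
Hypotheses (hH : forall i, H i (h i)) (alphaL : forall i, L i (alpha i)).
Hypothesis alpha_h : forall i, alpha i (h i) = 2.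
Implicit Types (i j k : 'I_n) (x y l : dual) (s t : seq 'I_n) (J : set 'I_n).

Definition pairing x i : R := x (h i).
Local Notation "<< x , i >>" := (pairing x i) (format "<< x ,  i >>").
Local Notation sg := (coxeter_refl H L).

Lemma pairingD x y i : << x + y, i >> = << x, i >> + << y, i >>.
Proof. by rewrite /pairing add_lfunE. Qed.

Lemma pairingZ (c : R) x i : << c *: x, i >> = c * << x, i >>.
Proof. by rewrite /pairing scale_lfunE. Qed.

Lemma pairingN x i : << - x, i >> = - << x, i >>.
Proof. by rewrite /pairing opp_lfunE. Qed.

Lemma pairing_alpha i : << alpha i, i >> = 2.
Proof. exact: alpha_h. Qed.

Definition pairingE := (pairingD, pairingZ, pairingN, pairing_alpha).

Lemma pairing_sum (I : Type) (r : seq I) (F : I -> dual) i :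
  << \sum_(k <- r) F k, i >> = \sum_(k <- r) << F k, i >>.
Proof. by rewrite /pairing sum_lfunE. Qed.

(** Bundling the pairing as a linear map makes its kernel, the wall of [i], a subspace with a
    dimension. *)
Definition pairing_lfun i : 'Hom(dual, R^o) :=
  let f := fun l : dual => << l, i >> : R^o in
  let f_lin : linear f := fun c x y =>
    etrans (pairingD _ _ _) (congr1 (+%R^~ _) (pairingZ _ _ _)) in
  linfun (HB.pack_for {linear dual -> R^o} f (GRing.isLinear.Build R dual R^o *:%R f f_lin)).

Lemma pairing_lfunE i l : pairing_lfun i l = << l, i >>.
Proof. by rewrite lfunE. Qed.

Lemma mem_ker_pairing i l : (l \in lker (pairing_lfun i)) = (<< l, i >> == 0).
Proof. by rewrite memv_ker pairing_lfunE. Qed.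

Lemma reflE i l : sg i l = l - << l, i >> *: alpha i.
Proof. by apply: coxeter_reflE; [exact: lcs_rayH HL i|exact: lcs_rayL HL i|..]. Qed.

Lemma pairing_refl i l : << sg i l, i >> = - << l, i >>.
Proof. by rewrite reflE !pairingE; lra. Qed.

Lemma reflK i l : sg i (sg i l) = l.
Proof. by rewrite reflE pairing_refl scaleNr opprK reflE subrK. Qed.

Lemma alpha_neq0 i : alpha i != 0.
Proof.
by apply: contra_eq_neq (pairing_alpha i) => ->; rewrite /pairing zero_lfunE eq_sym pnatr_eq0.
Qed.

Lemma refl_fix i l : (sg i l = l) <-> << l, i >> = 0.
Proof.
rewrite reflE; split=> [/eqP|->]; last by rewrite scale0r subr0.
by rewrite -subr_eq0 addrAC subrr add0r oppr_eq0 scaler_eq0 (negPf (alpha_neq0 i)) orbF => /eqP.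
Qed.

Lemma h_neq0 i : h i != 0.
Proof. by apply: contra_eq_neq (alpha_h i) => ->; rewrite linear0 eq_sym pnatr_eq0. Qed.

Lemma rayP i (x : hV) : H i x <-> exists2 t, 0 <= t & x = t *: h i.
Proof.
have h0 := h_neq0 i; have := hH i; have [x0 x0_neq0 ->] := lcs_rayH HL i.
move=> [u /= u0 uE]; have u_neq0 : u != 0 by apply: contraNneq h0 => u0'; rewrite -uE u0' scale0r.
split=> [[t /= t0 <-]|[t t0 ->]]; last by exists (t * u); rewrite ?mulr_ge0 //= -uE scalerA.
by exists (t / u); rewrite ?divr_ge0 // -uE scalerA divfK.
Qed.

Lemma closed_chamberP l : closed_chamber H l <-> forall i, 0 <= << l, i >>.
Proof.
split=> [lC i|lC i _ x /rayP[t t0 ->]]; first exact: lC.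
rewrite linearZ; exact (mulr_ge0 t0 (lC i)).
Qed.

Lemma open_chamberP l : open_chamber H l <-> forall i, 0 < << l, i >>.
Proof.
split=> [lC i|lC i _ x /rayP[t t0 ->]].
  apply: (lC i) => //.
  exact: h_neq0.
rewrite scaler_eq0 negb_or linearZ => /andP[t_neq0 _].
have t_gt0 : 0 < t by rewrite lt_def t_neq0.
exact (mulr_gt0 t_gt0 (lC i)).
Qed.

Lemma dual_eq0P i l : dual_eq0 (H i) l <-> << l, i >> = 0.
Proof.
split=> [|l0 x /rayP[t _ ->]]; first by apply.
by rewrite linearZ /= (l0 : l (h i) = 0) scaler0.
Qed.

(** * Facets and interior points of the closed chamber *)

(** The chamber spans the dual, so the span of its facet has codimension 1; being contained in the
    proper subspace [lker (pairing_lfun j)], it equals this hyperplane. *)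
Lemma facet_span j (U : {vspace dual}) l :
    closed_chamber H `&` dual_eq0 (H j) `<=` [set` U] ->
  << l, j >> = 0 -> l \in U.
Proof.
move=> FU lj0; have [_ [V [V' [[FV Vmin] [CV' V'min] dimV]]]] :
  codim1_face (closed_chamber H) (closed_chamber H `&` dual_eq0 (H j)).
  by apply/(lcs_facets HL); exists j.
have V'E : V' = fullv.
  by apply/eqP; rewrite eqEsubv subvf /=; apply: (lcs_chamber_span HL).2.
have VU := Vmin _ FU; apply: (subvP VU).
pose K := lker (pairing_lfun j).
have VK : (V <= K)%VS.
  apply: Vmin => x [_ /dual_eq0P xj] /=.
  by rewrite mem_ker_pairing xj.
suff -> : V = K by rewrite mem_ker_pairing lj0.
apply/eqP; rewrite eqEdim VK /= -ltnS -dimV V'E.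
rewrite (ltn_leqif (dimv_leqif_sup (subvf K))).
apply/negP => /subvP/(_ (alpha j) (memvf _)).
by rewrite mem_ker_pairing pairing_alpha pnatr_eq0.
Qed.

Lemma pairing_sum_gt0 (F : 'I_n -> dual) i :
    (forall k, 0 <= << F k, i >>) -> (exists k, 0 < << F k, i >>) ->
  0 < << \sum_k F k, i >>.
Proof.
move=> F0 [k Fk]; rewrite pairing_sum (bigD1 k) //=.
by rewrite ltr_pwDl // sumr_ge0.
Qed.

(** If the whole facet of [j] lay on the wall of [i], the wall of [j] would lie in that of [i] by
    [facet_span], hence equal it, and the two facets would agree, against [lcs_facets_inj]. Summing
    one suitable point for each [i] gives [p]. *)
Lemma facet_point j : exists p : dual, << p, j >> = 0 /\ forall i, i != j -> 0 < << p, i >>.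
Proof.
have /choice [q qP] : forall i, exists q : dual, [/\ closed_chamber H q,
    << q, j >> = 0 & i != j -> 0 < << q, i >>].
  move=> i; have [->|ij] := eqVneq i j.
    exists 0; split=> //; last by rewrite /pairing zero_lfunE.
    by apply/closed_chamberP => k; rewrite /pairing zero_lfunE.
  apply: contrapT => noq.
  have F0 l : closed_chamber H l -> << l, j >> = 0 -> << l, i >> = 0.
    move=> lC lj; apply: contrapT => li; apply: noq; exists l; split=> // _.
    by rewrite lt_def; have /closed_chamberP -> := lC; rewrite andbT; apply/eqP.
  have jK : forall l, << l, j >> = 0 -> << l, i >> = 0.
    move=> l lj; apply/eqP; rewrite -mem_ker_pairing.
    apply: facet_span lj => x [xC /dual_eq0P xj] /=.
    by rewrite mem_ker_pairing F0.
  have iK l : << l, i >> = 0 -> << l, j >> = 0.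
    move=> li.
    (* Otherwise the projection of [alpha i] along [alpha j] to the wall of [j] would still take the
       value 2 on [h i], against [jK]. *)
    have aji : << alpha j, i >> != 0.
      apply/eqP => aji; have := jK (alpha i - (<< alpha i, j >> / 2) *: alpha j).
      by rewrite !pairingE aji; lra.
    have := jK (l - (<< l, j >> / 2) *: alpha j); rewrite !pairingE li => lE.
    have /eqP : << l, j >> / 2 * << alpha j, i >> = 0 by lra.
    by rewrite mulf_eq0 (negPf aji) orbF => /eqP; lra.
  have /eqP := ij; apply; apply: (lcs_facets_inj HL).
  by apply/seteqP; split=> x [xC /dual_eq0P x0]; split=> //; apply/dual_eq0P; auto.
exists (\sum_k q k); split=> [|i ij].
  by rewrite pairing_sum big1 // => k _; have [] := qP k.
apply: pairing_sum_gt0 => [k|]; last by exists i; have [_ _] := qP i; exact.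
by have [/closed_chamberP] := qP k.
Qed.

(** As the closed chamber spans, no pairing vanishes on it; the witnesses for all [i] are added
    up. *)
Lemma open_chamber_point : exists c : dual, forall i, 0 < << c, i >>.
Proof.
have /choice [q qP] : forall i, exists q : dual, closed_chamber H q /\ 0 < << q, i >>.
  move=> i; apply: contrapT => noq.
  have : (fullv <= lker (pairing_lfun i))%VS.
    apply: (lcs_chamber_span HL).2 => l lC /=; rewrite mem_ker_pairing.
    apply: contrapT => /negP li; apply: noq; exists l; split=> //.
    by rewrite lt_def li; have /closed_chamberP -> := lC.
  move=> /subvP/(_ (alpha i) (memvf _)).
  by rewrite mem_ker_pairing pairing_alpha pnatr_eq0.
exists (\sum_k q k) => i; apply: pairing_sum_gt0 => [k|].
  by have [/closed_chamberP] := qP k.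
by exists i; have [] := qP i.
Qed.

(** * Group elements as words in the reflections *)

Definition word_prod s : 'End(dual) := foldr (fun i w => (sg i \o w)%VF) \1%VF s.

Lemma word_prod_nil l : word_prod [::] l = l.
Proof. exact: id_lfunE. Qed.

Lemma word_prod_cons i s l : word_prod (i :: s) l = sg i (word_prod s l).
Proof. exact: comp_lfunE. Qed.

Lemma word_prod_cat s t l : word_prod (s ++ t) l = word_prod s (word_prod t l).
Proof. by elim: s => [|i s IH]; rewrite ?word_prod_nil // cat_cons !word_prod_cons IH. Qed.

Lemma word_prod_rcons s i l : word_prod (rcons s i) l = word_prod s (sg i l).
Proof. by rewrite -cats1 word_prod_cat word_prod_cons word_prod_nil. Qed.

Lemma word_prod_revK s : cancel (word_prod s) (word_prod (rev s)).
Proof.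
elim: s => [|i s IH] l; first by rewrite /rev /= !word_prod_nil.
by rewrite rev_cons word_prod_rcons word_prod_cons reflK IH.
Qed.

Lemma word_prod_Krev s : cancel (word_prod (rev s)) (word_prod s).
Proof. by move=> l; rewrite -{1}[s]revK word_prod_revK. Qed.

Lemma lker_word_prod s : lker (word_prod s) = 0%VS.
Proof. by apply/eqP/lker0P; exact: can_inj (word_prod_revK s). Qed.

Lemma word_prod_subgroup J :
  is_subgroup [set w | exists2 s, (forall i, i \in s -> J i) & w = word_prod s].
Proof.
split=> [_ [s _ ->]||_ _ [s Js ->] [t Jt ->]|_ [s Js ->]].
- exact: lker_word_prod.
- by exists [::].
- exists (s ++ t); first by move=> i; rewrite mem_cat => /orP[/Js|/Jt].
  by apply/lfunP => l; rewrite comp_lfunE word_prod_cat.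
- exists (rev s); first by move=> i; rewrite mem_rev => /Js.
  apply/lfunP => l; apply: (can_inj (word_prod_revK s)).
  by rewrite word_prod_Krev lker0_lfunVK // lker_word_prod.
Qed.

Lemma parabolicP J w : parabolic H L J w <->
  exists2 s, (forall i, i \in s -> J i) & w = word_prod s.
Proof.
split=> [|[s Js ->] G [[_ G1 GM _] SG]].
  move=> /(_ [set w | exists2 s, (forall i, i \in s -> J i) & w = word_prod s]); apply.
  split; first exact: word_prod_subgroup.
  move=> _ [i Ji <-]; exists [:: i]; first by move=> j; rewrite inE => /eqP ->.
  by apply/lfunP => l; rewrite word_prod_cons word_prod_nil.
elim: s Js => [//|i s IH] Js; apply: GM.
  by apply: SG; exists i => //; apply: Js; rewrite mem_head.
by apply: IH => j js; apply: Js; rewrite inE js orbT.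
Qed.

Lemma coxeter_word s : coxeter_group H L (word_prod s).
Proof. by apply/parabolicP; exists s. Qed.

Lemma word_prod_id s x : (forall i, 0 < << x, i >>) ->
  (forall i, 0 < << word_prod s x, i >>) -> forall l, word_prod s l = l.
Proof.
move=> xC sxC l; have [->|/eqP s1] := eqVneq (word_prod s) \1%VF; first exact: id_lfunE.
have /seteqP[/(_ (word_prod s x)) + _] := lcs_chamber_disj HL (coxeter_word s) s1.
by case; split; [exists x => //|]; apply/open_chamberP.
Qed.

(* A point of [w C] on the hyperplane of [i] would be fixed by the reflection [i], so
   that [w^-1 sg_i w] would fix a point of [C]. *)
Lemma pairing_word_neq0 s x i : (forall k, 0 < << x, k >>) -> << word_prod s x, i >> != 0.
Proof.
move=> xC; apply/eqP => sx0.
pose t := rev s ++ i :: s.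
have tE l : word_prod t l = word_prod (rev s) (sg i (word_prod s l)).
  by rewrite word_prod_cat word_prod_cons.
have t1 : forall l, word_prod t l = l.
  by apply: (word_prod_id xC) => k; rewrite tE ((refl_fix i _).2 sx0) word_prod_revK.
have : sg i (alpha i) = alpha i.
  by rewrite -{2}[alpha i](word_prod_Krev s) -[word_prod (rev s) _]t1 tE !word_prod_Krev.
by move/refl_fix; rewrite pairing_alpha => /eqP; rewrite pnatr_eq0.
Qed.

(** * Sides of walls and the exchange property *)

Section BasePoint.
Variable c : dual.
Hypothesis cC : forall i, 0 < << c, i >>.

(** If the two pairings had strictly opposite signs, the chosen [t] would put the image of
    [x + t *: c], a point of the open chamber, on the wall of [i]. *)
Lemma word_chamber_le0 s i x : (forall k, 0 <= << x, k >>) ->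
  << word_prod s c, i >> < 0 -> << word_prod s x, i >> <= 0.
Proof.
move=> xC sc; rewrite leNgt; apply/negP => sx.
pose t := - (<< word_prod s x, i >> / << word_prod s c, i >>).
have t0 : 0 < t by rewrite /t -mulrN -invrN divr_gt0 // oppr_gt0.
have yC k : 0 < << x + t *: c, k >> by rewrite !pairingE ltr_wpDl // mulr_gt0.
have := pairing_word_neq0 s i yC; rewrite linearD linearZ !pairingE /t mulNr divfK ?subrr ?eqxx //.
by rewrite lt_eqF.
Qed.

Lemma word_chamber_ge0 s i x : (forall k, 0 <= << x, k >>) ->
  0 < << word_prod s c, i >> -> 0 <= << word_prod s x, i >>.
Proof.
move=> xC sc; have := @word_chamber_le0 (i :: s) i x xC.
by rewrite !word_prod_cons !pairing_refl !oppr_lt0 oppr_le0; apply.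
Qed.

(* If [u C] and [u sg_j C] lie on different sides of the hyperplane of [i], then this
   hyperplane contains [u] of the facet of [j]. So [t = sg_j u^-1 sg_i u] fixes the
   hyperplane of [j] pointwise and keeps its sides, hence maps points of [C] close to
   the facet into [C], which forces [t = 1]. *)
Lemma wall_crossing s i j l :
    0 < << word_prod s c, i >> -> << word_prod s (sg j c), i >> < 0 ->
  sg i (word_prod s l) = word_prod s (sg j l).
Proof.
move=> sc scj; pose beta := (pairing_lfun i \o word_prod s)%VF.
have betaE x : (x \in lker beta) = (<< word_prod s x, i >> == 0).
  by rewrite memv_ker comp_lfunE pairing_lfunE.
have beta0 x : << x, j >> = 0 -> << word_prod s x, i >> = 0.
  move=> xj; apply/eqP; rewrite -betaE; apply: facet_span xj.
  move=> y [/closed_chamberP yC /dual_eq0P yj] /=; rewrite betaE.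
  apply/eqP/le_anti; rewrite (word_chamber_ge0 yC sc) andbT.
  have := @word_chamber_le0 (rcons s j) i y yC; rewrite !word_prod_rcons.
  by rewrite (refl_fix j y).2 //; apply.
pose t := j :: rev s ++ i :: s.
have tE x : word_prod t x = sg j (word_prod (rev s) (sg i (word_prod s x))).
  by rewrite word_prod_cons word_prod_cat word_prod_cons.
have t_fix x : << x, j >> = 0 -> word_prod t x = x.
  by move=> xj; rewrite tE (refl_fix i _).2 ?beta0 // word_prod_revK (refl_fix j _).2.
pose gamma := word_prod (rev s) (alpha i).
(* The map [beta] vanishes on the wall of [j], so it is a multiple of the pairing with [h j]; its
   value 2 at [gamma] gives the normalisation behind this equality. *)
have t_c : << word_prod t c, j >> = << c, j >>.
  rewrite tE pairing_refl reflE linearB linearZ /= word_prod_revK -/gamma.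
  have bE x : << word_prod s x, i >> = << x, j >> / 2 * << word_prod s (alpha j), i >>.
    have := beta0 (x - (<< x, j >> / 2) *: alpha j).
    rewrite linearB /= [word_prod s (_ *: _)]linearZ /= !pairingE => b0.
    by have := b0 _; lra.
  have := bE gamma; rewrite word_prod_Krev pairing_alpha => gE; rewrite (bE c) !pairingE.
  transitivity (<< c, j >> * (<< gamma, j >> / 2 * << word_prod s (alpha j), i >>) - << c, j >>).
    by lra.
  by rewrite -gE; lra.
have [p [pj pC]] := facet_point j.
have [d d0 dP] : exists2 d : R, 0 < d & forall k e, 0 < e -> e <= d ->
    0 < << p, k >> + e * << word_prod t c, k >>.
  apply: finite_eventually_small => k; have [->|kj] := eqVneq k j.
    by exists 1 => // e e0 _; rewrite pj add0r t_c mulr_gt0.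
  exact: small_perturb_gt0 (pC _ kj).
have t1 : word_prod t l = l.
  apply: (@word_prod_id _ (p + d *: c)) => k.
    rewrite !pairingE; have [->|kj] := eqVneq k j; first by rewrite pj add0r mulr_gt0.
    by rewrite addr_gt0 ?pC ?mulr_gt0.
  by rewrite linearD /= [word_prod t (_ *: _)]linearZ /= t_fix // !pairingE dP.
by rewrite -{2}t1 tE reflK word_prod_Krev.
Qed.

(** Either the prefix is already on the negative side and the recursion shortens it, or the last
    letter [j] crosses the wall of [i] and [wall_crossing] turns [sg i] into a second [sg j] that
    cancels it. *)
Lemma word_exchange s i : << word_prod s c, i >> < 0 ->
  exists2 t, (size t).+1 = size s & forall l, sg i (word_prod s l) = word_prod t l.
Proof.
elim/last_ind: s => [|s j IH]; first by rewrite word_prod_nil ltNge ltW.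
rewrite word_prod_rcons size_rcons => scj.
have [/IH[t ts tE]|sc] := ltP << word_prod s c, i >> 0.
  by exists (rcons t j) => [|l]; rewrite ?size_rcons ?ts // !word_prod_rcons tE.
exists s => // l; rewrite word_prod_rcons.
rewrite (wall_crossing (j := j)) ?reflK //.
by rewrite lt_def sc pairing_word_neq0.
Qed.

End BasePoint.

(** By [word_chamber_ge0], one point of the closed chamber sent to the negative side forces the base
    point there too. *)
Lemma word_negative_exchange s i x : (forall k, 0 <= << x, k >>) ->
    << word_prod s x, i >> < 0 ->
  exists2 t, (size t).+1 = size s & forall l, sg i (word_prod s l) = word_prod t l.
Proof.
have [c cC] := open_chamber_point => xC sx; apply: (word_exchange cC).
rewrite ltNge; apply/negP => sc; have := @word_chamber_ge0 c cC s i x xC.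
by rewrite lt_def pairing_word_neq0 // sc leNgt sx => /(_ isT).
Qed.

(** * Stabilizers of chamber points and descent by parabolic subgroups *)

(** Induction on word length. If the image of [c] is on the negative side of the wall of the first
    letter, the image of [x] lies on this wall, so the letter can be stripped and turns out to fix
    [x]. Otherwise the rest of the word is on the negative side, and exchange yields a shorter word
    for the same element. *)
Lemma chamber_stabilizer s x :
    (forall k, 0 <= << x, k >>) -> (forall k, 0 <= << word_prod s x, k >>) ->
  word_prod s x = x /\
  exists2 t, (forall i, i \in t -> << x, i >> = 0) & word_prod s = word_prod t.
Proof.
have [c cC] := open_chamber_point.
elim: (size s).+1 {-2}s (ltnSn (size s)) x => // m IH {}s sm x xC sxC.
case: s sm sxC => [|i s] sm sxC; first by split; [exact: word_prod_nil|exists [::]].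
have := @pairing_word_neq0 (i :: s) c i cC; rewrite neq_lt => /orP[isc|isc].
  have : << word_prod (i :: s) x, i >> = 0.
    by apply/le_anti; rewrite (word_chamber_le0 cC xC isc) sxC.
  move=> sx0; have sE : word_prod (i :: s) x = word_prod s x.
    by rewrite -[LHS](refl_fix i _).2 // word_prod_cons reflK.
  have [|sx [t tP tE]] := IH s sm x xC; first by move=> k; rewrite -sE.
  split; first by rewrite sE.
  exists (i :: t) => [j|]; last by apply/lfunP => l; rewrite !word_prod_cons tE.
  by rewrite inE => /orP[/eqP ->|/tP //]; rewrite -sx -sE.
have [|t ts tE] := word_exchange cC (s := s) (i := i).
  by move: isc; rewrite word_prod_cons pairing_refl oppr_gt0.
have E : word_prod (i :: s) = word_prod t by apply/lfunP => l; rewrite word_prod_cons.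
rewrite E; apply: IH => //; last by rewrite -E.
by move: sm; rewrite ltnS /= -ts => /ltnW.
Qed.

(** Reflecting in a wall of [J] that has the point on its negative side shortens the word by
    exchange, so the process stops. *)
Lemma descend J s x : (forall k, 0 <= << x, k >>) ->
  exists2 t, (forall i, i \in t -> J i) &
    forall j, J j -> 0 <= << word_prod t (word_prod s x), j >>.
Proof.
move=> xC; elim: (size s).+1 {-2}s (ltnSn (size s)) => // m IH {}s sm.
have [sJ|/existsNP[i /not_implyP[Ji /negP]]] :=
    pselect (forall j, J j -> 0 <= << word_prod s x, j >>).
  by exists [::] => // j /sJ; rewrite word_prod_nil.
rewrite -ltNge => /(word_negative_exchange xC)[t ts tE].
have [|u uJ uP] := IH t; first by rewrite -ltnS ts.
exists (rcons u i) => [j|j Jj]; last by rewrite word_prod_rcons tE uP.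
by rewrite mem_rcons inE => /orP[/eqP ->|/uJ].
Qed.

Lemma word_fix s l : (forall i, i \in s -> sg i l = l) -> word_prod s l = l.
Proof.
elim: s => [|i s IH] sl; first exact: word_prod_nil.
rewrite word_prod_cons IH => [|j js]; first by apply: sl; rewrite mem_head.
by apply: sl; rewrite inE js orbT.
Qed.

Lemma word_stable s (A : set dual) :
  (forall i, i \in s -> sg i @` A = A) -> word_prod s @` A = A.
Proof.
elim: s => [|i s IH] sA.
  by apply/seteqP; split=> [_ [x Ax <-]|x Ax]; [|exists x]; rewrite ?word_prod_nil.
have iA : sg i @` A = A by apply: sA; rewrite mem_head.
rewrite -[RHS]iA -{2}IH => [|j js]; last by apply: sA; rewrite inE js orbT.
apply/seteqP; split=> [_ [x Ax <-]|_ [_ [x Ax <-] <-]].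
  by exists (word_prod s x); [exists x|rewrite word_prod_cons].
by exists x; rewrite ?word_prod_cons.
Qed.

Lemma word_stable_in s (A : set dual) x :
  word_prod s @` A = A -> A x -> A (word_prod s x).
Proof. by move=> {2}<- Ax; exists x. Qed.

(** * Facets of the chamber and facial sets *)

Lemma closed_facet_chamber (A : set dual) J :
  (forall i l, J i -> A l -> << l, i >> = 0) ->
  A `&` closed_facet h J = A `&` closed_chamber H.
Proof.
move=> AJ; apply/seteqP; split=> l [Al lP]; split=> //.
  apply/closed_chamberP => i; have [Ji|nJi] := pselect (J i); first by rewrite (AJ i).
  exact: (lP i).2 nJi.
by move=> i; split=> [Ji|_]; [exact: AJ|exact: (closed_chamberP l).1].
Qed.

(** The functional [l] exposes the face: it is nonnegative on the full cone and vanishes there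
    exactly on [ray_sum h J]. *)
Lemma facial_of_open_facet J l : open_facet h J l -> facial h J.
Proof.
move=> lJ.
have lS (c : 'I_n -> R) (P : pred 'I_n) :
    l (\sum_(j | P j) c j *: h j) = \sum_(j | P j) c j * l (h j).
  by rewrite linear_sum; apply: eq_bigr => j _; rewrite linearZ.
have coneP K : convex_cone (ray_sum h K).
  split=> [_ _ [c c0 <-] [d d0 <-]|t _ t0 [c c0 <-]].
    exists (fun j => c j + d j) => [j|]; first exact: addr_ge0.
    by rewrite -big_split; apply: eq_bigr => j _; rewrite scalerDl.
  exists (fun j => t * c j) => [j|]; first by rewrite mulr_ge0 // ltW.
  by rewrite scaler_sumr; apply: eq_bigr => j _; rewrite scalerA.
have l_ge0 i : 0 <= l (h i).
  by have [Ji|nJi] := pselect (J i); [rewrite (lJ i).1|rewrite ltW // (lJ i).2].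
have l_pos (x : hV) : ray_sum h setT x -> 0 <= l x.
  move=> [c c0 <-]; rewrite lS; apply: sumr_ge0 => j _; exact: mulr_ge0.
have l_zero (x : hV) : ray_sum h J x -> l x = 0.
  move=> [c c0 <-]; rewrite lS big1 // => j; rewrite inE => Jj.
  by rewrite (lJ j).1 // mulr0.
have zero_J (x : hV) : ray_sum h setT x -> l x = 0 -> ray_sum h J x.
  (* A zero sum of nonnegative terms has only zero terms, so the coefficients outside [J], where [l]
     is positive, vanish. *)
  move=> [c c0 <-]; rewrite lS => /eqP.
  rewrite psumr_eq0 => [/allP c_eq0|j _]; last exact: mulr_ge0.
  exists c => //; rewrite [RHS](bigID (fun j => j \in J)) /= [X in _ = _ + X]big1 ?addr0.
    by apply: eq_bigl => j; rewrite in_setT.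
  move=> j /andP[_ /negP]; rewrite inE => nJj.
  have := c_eq0 j (mem_index_enum _); rewrite in_setT /= mulf_eq0 => /orP[/eqP ->|/eqP lj].
    by rewrite scale0r.
  by have := (lJ j).2 nJj; rewrite lj ltxx.
split; first exact: coneP.
  move=> _ [c c0 <-]; exists (fun j => if j \in J then c j else 0) => [j /=|]; first by case: ifP.
  rewrite [LHS](bigID (fun j => j \in J)) /= [X in _ + X = _]big1 ?addr0.
    by apply: eq_big => [j|j /andP[_ ->] //]; rewrite in_setT.
  by move=> j /andP[_ /negPf ->]; rewrite scale0r.
move=> x y [Kx nJx] Ky; split; first exact: (coneP _).1.
move=> /l_zero; rewrite linearD => xy0; apply: nJx; apply: zero_J => //.
apply/le_anti; rewrite l_pos // andbT -xy0.
by rewrite -[X in X <= _]addr0 lerD2l l_pos.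
Qed.

(** * Faces of [Y] whose relative interior meets the closed chamber *)

Section Face.
Variables (Y Q : set dual).
Hypotheses (Y_cone : convex_cone Y) (Y_tits : Y `<=` tits_cone H L).
Hypotheses (Y_inv : coxeter_invariant H L Y) (Q_Upsilon : Upsilon H Y Q).

Let Q_face : face Y Q. Proof. by case: Q_Upsilon => -[]. Qed.
Let Q_cone : convex_cone Q. Proof. by case: Q_face. Qed.
Let QY : Q `<=` Y. Proof. by case: Q_face. Qed.

Lemma upsilon_lowP i : upsilon_low H L Q i <-> forall l, Q l -> << l, i >> = 0.
Proof. by split=> Qi l /Qi /refl_fix. Qed.

Lemma Upsilon_tits l : Q l -> exists s x, (forall i, 0 <= << x, i >>) /\ l = word_prod s x.
Proof.
move=> /QY/Y_tits[_ /parabolicP[s _ ->] [x /closed_chamberP xC <-]].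
by exists s, x.
Qed.

Lemma word_face s : face Y (word_prod s @` Q).
Proof.
have Ys := Y_inv (coxeter_word s); have [QD QZ] := Q_cone; have [_ _ QF] := Q_face.
split.
- split=> [_ _ [x Qx <-] [y Qy <-]|t _ t0 [x Qx <-]].
    by exists (x + y); [exact: QD|rewrite linearD].
  by exists (t *: x); [exact: QZ|rewrite linearZ].
- by move=> _ [x Qx <-]; apply: word_stable_in Ys (QY Qx).
- move=> x y [Yx nQx] Yy; move: Yx Yy nQx.
  rewrite -{1 2}Ys => -[x' Yx' <-] [y' Yy' <-] nQx.
  have [|Yxy nQxy] := QF x' y' _ Yy'; first by split=> // Qx'; apply: nQx; exists x'.
  rewrite -linearD; split; first exact: word_stable_in Ys Yxy.
  by move=> [z Qz /(can_inj (word_prod_revK s)) zE]; apply: nQxy; rewrite -zE.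
Qed.

Lemma word_fix_ri_sub s x : ri Q x -> word_prod s x = x -> Q `<=` word_prod s @` Q.
Proof.
move=> xQ sx; apply: (ri_sub_face Y_cone (word_face s) QY xQ).
by exists x => //; case: xQ.
Qed.

(** The reversed word, which gives the inverse, fixes [x] too and supplies the other inclusion. *)
Lemma word_fix_ri_stable s x : ri Q x -> word_prod s x = x -> word_prod s @` Q = Q.
Proof.
move=> xQ sx; apply/seteqP; split; last exact: word_fix_ri_sub xQ sx.
move=> _ [y Qy <-]; have [|z Qz <-] := word_fix_ri_sub (s := rev s) xQ _ Qy.
  by rewrite -{1}sx word_prod_revK.
by rewrite word_prod_Krev.
Qed.

Lemma refl_fix_ri_stable i x : ri Q x -> << x, i >> = 0 -> sg i @` Q = Q.
Proof.
move=> xQ xi; have := @word_fix_ri_stable [:: i] x xQ; rewrite word_prod_cons word_prod_nil.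
move=> /(_ ((refl_fix i x).2 xi)) {2}<-.
by apply/seteqP; split=> _ [y Qy <-]; exists y; rewrite ?word_prod_cons ?word_prod_nil.
Qed.

(** If a wall through [l] misses some [x] in [Q], reflections fixing [l] move [x] within [Q] to a
    point [y] on the nonnegative side of all walls through [l]. A small step from [l] towards [y]
    stays in [ri Q] and in the chamber, meets no new wall and leaves at least one. *)
Lemma ri_generic : exists l : dual, [/\ ri Q l, forall i, 0 <= << l, i >> &
  forall i, << l, i >> = 0 -> upsilon_low H L Q i].
Proof.
have [_ [l [lQ /closed_chamberP lC]]] := Q_Upsilon.
elim: #|[pred i | << l, i >> == 0]|.+1 {-2}l (ltnSn #|[pred i | << l, i >> == 0]|) lQ lC
  => // m IH {}l lm lQ lC.
have [lP|/existsNP[i /not_implyP[li /upsilon_lowP/existsNP[x /not_implyP[Qx xi]]]]] :=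
  pselect (forall i, << l, i >> = 0 -> upsilon_low H L Q i); first by exists l.
have [s [x0 [x0C xE]]] := Upsilon_tits Qx.
have [t tl tx] := descend (fun j => << l, j >> = 0) s x0C; rewrite -xE in tx.
set y := word_prod t x in tx.
have tfix z : (forall j, << l, j >> = 0 -> << z, j >> = 0) -> word_prod t z = z.
  by move=> zl; apply: word_fix => j /tl/zl/refl_fix.
have Qy : Q y by apply: word_stable_in Qx; apply: (word_fix_ri_stable lQ); exact: tfix.
have [j [lj yj]] : exists j, << l, j >> = 0 /\ 0 < << y, j >>.
  apply: contrapT => noj.
  have y0 j : << l, j >> = 0 -> << y, j >> = 0.
    move=> lj; apply/eqP; rewrite eq_le tx // andbT leNgt; apply/negP => yj.
    by apply: noj; exists j.
  (* With [y] on all walls through [l], the word [t] would fix [y], so [x] would equal [y] and lie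
     on the wall of [i]. *)
  by apply: xi; rewrite -[x](word_prod_revK t) -/y -{1}(tfix _ y0) word_prod_revK y0.
have [d d0 dP] : exists2 d : R, 0 < d & forall k e, 0 < e -> e <= d ->
    << l, k >> != 0 -> 0 < << l, k >> + e * (<< y, k >> - << l, k >>).
  apply: finite_eventually_small => k; have [->|lk] := eqVneq << l, k >> 0.
    by exists 1.
  have [|d d0 dP] := @small_perturb_gt0 R << l, k >> (<< y, k >> - << l, k >>).
    by rewrite lt_def lk lC.
  by exists d => // e e0 ed _; exact: dP.
(* The bound [d] preserves the positive pairings of [l]; the bound 1/2 keeps [z] strictly inside the
   segment, as [ri_segment] requires. *)
pose e := Num.min d (1 / 2).
have e0 : 0 < e by rewrite lt_min d0; lra.
have e1 : e < 1 by rewrite gt_min; apply/orP; right; lra.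
have ed : e <= d by rewrite ge_min lexx.
pose z := (1 - e) *: l + e *: y.
have zk k : << z, k >> = << l, k >> + e * (<< y, k >> - << l, k >>) by rewrite !pairingE; lra.
have zpos k : << l, k >> != 0 -> 0 < << z, k >> by rewrite zk; exact: dP.
have z0 k : << l, k >> = 0 -> << z, k >> = e * << y, k >> by rewrite zk => ->; rewrite subr0 add0r.
apply: (IH z); last 2 first.
- exact: ri_segment.
- move=> k; have [lk|lk] := eqVneq << l, k >> 0; last by rewrite ltW ?zpos.
  by rewrite z0 // mulr_ge0 ?tx // ltW.
rewrite ltnS in lm; apply: leq_trans lm; apply: proper_card; apply/properP; split.
  apply/fintype.subsetP => k; rewrite !inE; apply: contraTT => lk; rewrite gt_eqF //.
  exact: zpos.
by exists j; rewrite inE ?lj // z0 // gt_eqF // mulr_gt0.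
Qed.

Lemma Upsilon_descend l x : ri Q l -> (forall i, 0 <= << l, i >>) ->
    (forall i, << l, i >> = 0 -> upsilon_low H L Q i) -> Q x ->
  exists t, [/\ forall i, i \in t -> upsilon_up H L Q i,
    Q (word_prod t x) & forall i, 0 <= << word_prod t x, i >>].
Proof.
move=> lQ lC lP Qx; have [s [x0 [x0C xE]]] := Upsilon_tits Qx.
have [t tup tx] := descend (upsilon_up H L Q) s x0C; rewrite -xE in tx.
have Qtx : Q (word_prod t x).
  by apply: word_stable_in Qx; apply: word_stable => i /tup[].
exists t; split=> // i; rewrite leNgt; apply/negP.
set y := word_prod t x in tx Qtx * => yi.
have not_low : ~ upsilon_low H L Q i.
  by move=> /upsilon_lowP/(_ _ Qtx) yi0; rewrite yi0 ltxx in yi.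
have li : 0 < << l, i >>.
  by rewrite lt_def lC andbT; apply/eqP => /lP.
have yl : 0 < << l, i >> - << y, i >> by lra.
(* The parameter at which the segment from [l] to [y] meets the wall of [i]. *)
pose e := << l, i >> / (<< l, i >> - << y, i >>).
have up_i : upsilon_up H L Q i.
  split=> //; apply: (@refl_fix_ri_stable i ((1 - e) *: l + e *: y)).
    apply: ri_segment => //; first exact: divr_gt0.
    by rewrite ltr_pdivrMr // mul1r; lra.
  by rewrite !pairingE /e; field; rewrite gt_eqF.
by have := tx _ up_i; rewrite leNgt yi.
Qed.

End Face.
End Reflections.

(** * Stabilizers and translates, read off at a generic point of the face *)

Theorem theorem4p3 (R : realType) (hV : vectType R) (n : nat)
    (H : 'I_n -> set hV) (L : 'I_n -> set 'Hom(hV, R^o))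
    (HL : linear_coxeter_system H L)
    (h : 'I_n -> hV) (alpha : 'I_n -> 'Hom(hV, R^o))
    (hH : forall i, H i (h i)) (alphaL : forall i, L i (alpha i))
    (alpha_h : forall i, alpha i (h i) = 2)
    (Y : set 'Hom(hV, R^o))
    (Y_cone : convex_cone Y) (Y0 : Y 0) (Y_tits : Y `<=` tits_cone H L)
    (Y_inv : coxeter_invariant H L Y)
    (Q : set 'Hom(hV, R^o)) (Q_Upsilon : Upsilon H Y Q) :
  (pointwise_stabilizer H L Q = parabolic H L (upsilon_low H L Q) /\
   setwise_stabilizer H L Q = parabolic H L (upsilon H L Q)) /\
  [/\ Q `&` closed_chamber H = Q `&` closed_facet h (upsilon_low H L Q),
      Q = translates (setwise_stabilizer H L Q) (Q `&` closed_chamber H),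
      Q = translates (parabolic H L (upsilon_up H L Q))
            (Q `&` closed_facet h (upsilon_low H L Q)),
      ri Q `&` open_facet h (upsilon_low H L Q) !=set0
    & facial h (upsilon_low H L Q)].
Proof.
pose low := upsilon_low H L Q.
have [l [lQ lC lP]] := ri_generic HL hH alphaL alpha_h Y_cone Y_tits Y_inv Q_Upsilon.
have Ql : Q l by case: lQ.
have lowE := upsilon_lowP HL hH alphaL alpha_h Q.
have QchE : Q `&` closed_chamber H = Q `&` closed_facet h low.
  by rewrite (closed_facet_chamber HL hH alpha_h) // => i x /lowE; apply.
have wordP J := parabolicP HL hH alphaL alpha_h J.
have chP := closed_chamberP HL hH alpha_h.
have desc := Upsilon_descend HL hH alphaL alpha_h Y_cone Y_tits Y_inv Q_Upsilon lQ lC lP.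
have revK := word_prod_revK HL hH alphaL alpha_h.
have low_upsilon : low `<=` upsilon H L Q.
  by move=> i li; apply/seteqP; split=> [_ [x Qx <-]|x Qx]; [|exists x]; rewrite ?li.
have stabP s (w := word_prod H L s) : (forall i, 0 <= pairing h (w l) i) ->
    parabolic H L low w.
  move=> /(chamber_stabilizer HL hH alphaL alpha_h lC)[_ [t tl wE]].
  by apply/wordP; exists t => // i /tl/lP.
have upN : parabolic H L (upsilon_up H L Q) `<=` setwise_stabilizer H L Q.
  move=> _ /wordP[s su ->]; split; first exact: (coxeter_word HL hH alphaL alpha_h).
  by apply: word_stable => i /su[].
(* Allowing any [G] between the group of [upsilon_up] and the setwise stabilizer covers both
   descriptions of [Q] at once. *)
have Qtrans G : parabolic H L (upsilon_up H L Q) `<=` G -> G `<=` setwise_stabilizer H L Q ->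
    Q = translates G (Q `&` closed_chamber H).
  move=> upG GN; apply/seteqP; split=> [x Qx|_ [w /GN[_ wQ] [x [Qx _] <-]]]; last first.
    by rewrite -wQ; exists x.
  have [t [tup Qtx txC]] := desc x Qx.
  exists (word_prod H L (rev t)).
    by apply: upG; apply/wordP; exists (rev t) => // i; rewrite mem_rev => /tup.
  by exists (word_prod H L t x); [split=> //; apply/chP|exact: revK].
split; split.
- apply/seteqP; split=> [_ [/wordP[s _ ->] sQ]|_ /wordP[s sl ->]].
    by apply: stabP; rewrite sQ.
  split; first exact: (coxeter_word HL hH alphaL alpha_h).
  by move=> x Qx; apply: word_fix => i /sl; apply.
- apply/seteqP; split=> [_ [/wordP[s _ ->] sQ]|_ /wordP[s su ->]]; last first.
    split; first exact: (coxeter_word HL hH alphaL alpha_h).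
    by apply: word_stable => i /su.
  (* The image of [l] stays in [Q], so some [t] over [upsilon_up] returns it to the chamber. The
     product of [t] and [s] then lies in the group of [low], and [s] is recovered by inverting
     [t]. *)
  have Qsl : Q (word_prod H L s l) by rewrite -sQ; exists l.
  have [t [tup _ tslC]] := desc _ Qsl.
  have /wordP[u ul uE] : parabolic H L low (word_prod H L (t ++ s)).
    by apply: stabP; rewrite word_prod_cat.
  apply/wordP; exists (rev t ++ u) => [i|].
    by rewrite mem_cat mem_rev => /orP[/tup[]|/ul/low_upsilon].
  by apply/lfunP => x; rewrite word_prod_cat -uE word_prod_cat revK.
- exact: QchE.
- exact: Qtrans.
- by rewrite -QchE; exact: Qtrans.
- exists l; split=> // i; split=> [/lowE|li]; first exact.
  rewrite lt_def; have := lC i; rewrite /pairing => ->; rewrite andbT.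
  by apply/eqP => /lP.
- apply: (@facial_of_open_facet _ _ _ h _ l) => i; split=> [/lowE|li]; first exact.
  rewrite lt_def; have := lC i; rewrite /pairing => ->; rewrite andbT.
  by apply/eqP => /lP.
Qed.
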